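(* Consider the iterative negotiation and oversight framework described in the context, with tax parameter $\kappa>0$. Let $\alpha_r=r$ and $r_{\max}:=\lceil \kappa B_{\max}\rceil$. Assume $\delta_r\le \bar\delta$ for all $r\le r_{\max}$ and let $\tau>0$ denote the desired optimality gap. To certify at termination that $$J_{\mathrm{sys}}\big(o_{r_{\mathrm{term}}}^{\mathrm{TACo}}\big)-J_{\mathrm{sys}}(o^{\mathrm{opt}})\le \tau$$ (that is, for the guaranteed upper bound $n\big(B_{\max}\bar\delta+\frac{B_{\max}}{r_{\mathrm{term}}}\big)$ on this gap to be at most $\tau$), it is necessary that $\tau>nB_{\max}\bar\delta$ and $$r_{\max} \;\ge\; \frac{n B_{\max}}{\tau - n B_{\max}\bar\delta},\quad\text{equivalently}\quad \kappa \;\ge\; \frac{1}{B_{\max}}\left\lfloor \frac{nB_{\max}}{\tau-nB_{\max}\bar\delta}\right\rfloor .$$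
   Context: Agents and costs. $\mathbf{N}=\{1,\dots,n\}$ is the set of agents and $\mathcal{O}$ is a finite set of feasible choices. Agent $i$ has an individual (intrinsic) cost $J_i^{\mathrm{ind}}:\mathcal{O}\to\mathbb{R}$, and $J^{\mathrm{ind}}(o)=[J_1^{\mathrm{ind}}(o),\dots,J_n^{\mathrm{ind}}(o)]^\top$. Agent $i$ has an asset reserve $R_i>0$; $\kappa>0$ is a tax parameter; agent $i$'s valuation of one unit of the traded asset is $b_i=1/(\kappa R_i)$. Put $B_i:=\max_{o,o'\in\mathcal{O}}|J_i^{\mathrm{ind}}(o)-J_i^{\mathrm{ind}}(o')|$ and $B_{\max}:=\max_i B_i$. Rounds. Rounds are indexed $r=1,2,\dots$, with coordination factor $\mathbf{w}^{(r)}\in\mathbb{R}^n_{\ge0}$, $\mathbf{w}^{(1)}=0$. Put $\alpha_r:=\|\mathbf{w}^{(r)}\|_1+1$, $\bar{\mathbf{w}}^{(r)}:=\mathbf{w}^{(r)}/\alpha_r$, $S_v(o):=v^\top J^{\mathrm{ind}}(o)$ for $v\in\mathbb{R}^n$, and define the effective cost $J_i^{\mathbf{w}^{(r)}}(o):=S_{\bar{\mathbf{w}}^{(r)}}(o)+\frac{1}{\alpha_r}J_i^{\mathrm{ind}}(o)$. In round $r$: (1) each agent $i$ generates $o_i^{(r)}\in\arg\min_{o\in\mathcal{O}}J_i^{\mathbf{w}^{(r)}}(o)$, and $\mathcal{O}^{(r)}=\{o_1^{(r)},\dots,o_n^{(r)}\}$; (2) the agents run TACo (below) on $\mathcal{O}^{(r)}$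 with costs given by the effective costs, yielding the agreed outcome $o_r^{\mathrm{TACo}}\in\mathcal{O}^{(r)}$, payments $P_i$ and offers $O_i$ (in asset units, for the agreed outcome); (3) with $e_i=P_i-O_i$ and shortfall $s_i=\frac{1}{R_i}\max\{0,e_i-R_i\}$, the process terminates if $\sum_i s_i=0$; (4) otherwise $\mathbf{w}^{(r+1)}=\mathbf{w}^{(r)}+\bar s$ with $\bar s_i=s_i/\sum_j s_j$. Hence $\alpha_{r+1}=\alpha_r+1$ and $\alpha_r=r$. The round at which the process terminates is $r_{\mathrm{term}}$. TACo (trading auction for consensus). Each agent $i$ has cost $C_{i\ell}$ for option $\ell$, and offer and payment units $O_{i\ell},P_{i\ell}\ge0$, initially zero. Agent $i$'s profit is $b_i(O_{i\ell}-P_{i\ell})-C_{i\ell}$. Agents take turns; the agent $i$ in turn selects a profit-maximizing option $\ell_i^*$, whereupon $P_{i\ell_i^*}$ increases by $nd$ and $O_{j\ell_i^*}$ increases by $d$ for every agent $j$, where $d>0$ is the current trading unit. When a cycle is detected (an agent's profits repeat at two different steps), $d$ is replaced by $\gamma d$ with fixed $\gamma\in(0,1)$. The procedure ends when all agents choose the same option or the profit gap among all options in a cycle falls below a tolerance $\varepsilon>0$, at which point a consensus is declared. Transfers. $t_i^{(r)}$ is agent $i$'s transfer value at round $r$, i.e., the value (at its valuation $b_i$) of the net assets it exchanges under $o_r^{\mathrm{TACo}}$. Transfer values are quantized: $|t_j^{(r)}|=c_j^{(r)}b_j$ with $c_j^{(r)}\in\mathbb{Z}_{\ge0}$ the trading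 quantity in fixed asset units. System optimality. $u=\frac1n\mathbf{1}^n$ (with $\mathbf{1}^n$ the all-ones vector), $J_{\mathrm{sys}}(o):=\sum_{i=1}^nJ_i^{\mathrm{ind}}(o)=nS_u(o)$, $o^{\mathrm{opt}}\in\arg\min_{o\in\mathcal{O}}J_{\mathrm{sys}}(o)$, and $\delta_r:=\|\bar{\mathbf{w}}^{(r)}-u\|_1$.
   Formalization: Termination within r_max rounds (hence B_max>0) is added, as the claim can fail without it; the floor form of the κ condition is proved except in the rounding cases where it differs from r_max ≥ x, and the exact equivalent κ > (⌈x⌉−1)/B_max, x = nB_max/(τ−nB_max δ̄), is given for all cases. *)

(* Defs.v *)
From HB Require Import structures.
From mathcomp Require Export all_boot all_order all_algebra.
From mathcomp Require Export reals.

Set Implicit Arguments.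
Unset Strict Implicit.
Unset Printing Implicit Defensive.

Import Order.TTheory GRing.Theory Num.Theory.
Local Open Scope ring_scope.

Definition argmin (R : realType) (T : finType) (f : T -> R) (o : T) : Prop :=
  forall o' : T, f o <= f o'.

Definition l1norm (R : realType) (n : nat) (v : 'cV[R]_n) : R :=
  \sum_(i < n) `|v i 0|.

(* Agents are 'I_n, feasible choices are the elements of Ch. *)
Record framework (R : realType) (n : nat) (Ch : finType) := Framework {
  Jind : 'I_n -> Ch -> R;
  reserve : 'I_n -> R;
  kappa : R;
  unit0 : R;    (* initial trading unit d *)
  gamma : R;
  epsilon : R;
  reserve_gt0 : forall i, 0 < reserve i;
  kappa_gt0 : 0 < kappa;
  unit0_gt0 : 0 < unit0;
  gamma_bounds : 0 < gamma < 1;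
  epsilon_gt0 : 0 < epsilon
}.

Section Framework.
Variables (R : realType) (n : nat) (Ch : finType) (F : framework R n Ch).

Definition valuation (i : 'I_n) : R := (kappa F * reserve F i)^-1.

(* The maxima are over nonnegative families, so the default value 0 only
   matters for empty families. *)
Definition Brange (i : 'I_n) : R :=
  \big[Num.max/0]_(o : Ch) \big[Num.max/0]_(o' : Ch) `|Jind F i o - Jind F i o'|.
Definition Bmax : R := \big[Num.max/0]_(i < n) Brange i.

Definition Sv (v : 'cV[R]_n) (o : Ch) : R := \sum_(i < n) v i 0 * Jind F i o.
Definition Jsys (o : Ch) : R := \sum_(i < n) Jind F i o.

Definition rmax : int := Num.ceil (kappa F * Bmax).

Section TACo.
Variables (C : 'I_n -> Ch -> R) (A : {set Ch}).

(* Step k takes state k (offers, payments, current trading unit) to state k.+1;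
   [sel k] is the option selected during step k, and the procedure ends in
   state [stop].  The sequences are unconstrained beyond [stop]. *)
Record taco_trace := TacoTrace {
  sel : nat -> Ch;
  offer : nat -> 'I_n -> Ch -> R;
  payment : nat -> 'I_n -> Ch -> R;
  trading_unit : nat -> R;
  stop : nat
}.

Variable tr : taco_trace.

Definition profit (k : nat) (i : 'I_n) (l : Ch) : R :=
  valuation i * (offer tr k i l - payment tr k i l) - C i l.

(* The agents move cyclically, in the order of their indices. *)
Definition in_turn (k : nat) (i : 'I_n) : bool := (i == k %% n :> nat)%N.

Definition profits_repeat (i : 'I_n) (s t : nat) : bool :=
  (s < t)%N && [forall l in A, profit s i l == profit t i l].

Definition cycle_detected (t : nat) : bool :=
  [exists s : 'I_t, [exists i : 'I_n, profits_repeat i s t]].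

Definition taco_init : Prop :=
  (forall i l, offer tr 0 i l = 0 /\ payment tr 0 i l = 0)
  /\ trading_unit tr 0 = unit0 F.

Definition taco_step (k : nat) : Prop :=
  [/\ sel tr k \in A,
      forall i, in_turn k i ->
        forall l, l \in A -> profit k i l <= profit k i (sel tr k),
      forall i l, payment tr k.+1 i l = payment tr k i l +
        (if in_turn k i && (l == sel tr k) then n%:R * trading_unit tr k else 0),
      forall i l, offer tr k.+1 i l = offer tr k i l +
        (if l == sel tr k then trading_unit tr k else 0)
    & trading_unit tr k.+1 =
        if cycle_detected k.+1 then gamma F * trading_unit tr k
        else trading_unit tr k].

(* The latest choices of all n agents coincide. *)
Definition unanimous (t : nat) (o : Ch) : Prop :=
  (n <= t)%N /\ forall k, (t - n <= k < t)%N -> sel tr k = o.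

(* The options of a cycle s..t are those selected between states s and t; the
   gap is taken over every pair of these options, for every agent.  The option
   declared is any option of the cycle. *)
Definition within_tolerance (t : nat) (o : Ch) : Prop :=
  exists s, exists i,
    [/\ profits_repeat i s t,
        forall j k k', (s <= k < t)%N -> (s <= k' < t)%N ->
          `|profit t j (sel tr k) - profit t j (sel tr k')| < epsilon F
      & exists2 k, (s <= k < t)%N & sel tr k = o].

Definition consensus (t : nat) (o : Ch) : Prop :=
  unanimous t o \/ within_tolerance t o.

Definition taco_run (o : Ch) : Prop :=
  [/\ taco_init,
      forall k, (k < stop tr)%N -> taco_step k,
      forall t o', (t < stop tr)%N -> ~ consensus t o'
    & consensus (stop tr) o].

End TACo.

(* The data of rounds r = 1, 2, ...; index 0 and the rounds after termination
   are unconstrained. *)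
Record negotiation := Negotiation {
  w : nat -> 'cV[R]_n;
  proposal : nat -> 'I_n -> Ch;
  trace : nat -> taco_trace;
  outcome : nat -> Ch
}.

Variable N : negotiation.

Definition alpha (r : nat) : R := l1norm (w N r) + 1.
Definition wbar (r : nat) : 'cV[R]_n := (alpha r)^-1 *: w N r.

Definition Jeff (r : nat) (i : 'I_n) (o : Ch) : R :=
  Sv (wbar r) o + (alpha r)^-1 * Jind F i o.

Definition proposals (r : nat) : {set Ch} := [set proposal N r i | i : 'I_n].

Definition net_payment (r : nat) (i : 'I_n) : R :=
  payment (trace N r) (stop (trace N r)) i (outcome N r)
  - offer (trace N r) (stop (trace N r)) i (outcome N r).

Definition shortfall (r : nat) (i : 'I_n) : R :=
  (reserve F i)^-1 * Num.max 0 (net_payment r i - reserve F i).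

Definition total_shortfall (r : nat) : R := \sum_(i < n) shortfall r i.

Definition transfer (r : nat) (i : 'I_n) : R := valuation i * net_payment r i.

Definition terminates_at (rterm : nat) : Prop :=
  [/\ (1 <= rterm)%N,
      w N 1 = 0,
      forall r, (1 <= r <= rterm)%N ->
        [/\ forall i, argmin (Jeff r i) (proposal N r i),
            taco_run (Jeff r) (proposals r) (trace N r) (outcome N r)
          & forall i, exists c : nat, `|transfer r i| = c%:R * valuation i],
      forall r, (1 <= r < rterm)%N ->
        total_shortfall r != 0
        /\ w N r.+1 = w N r + \col_i (shortfall r i / total_shortfall r)
    & total_shortfall rterm = 0].

Definition delta (r : nat) : R := l1norm (wbar r - const_mx (n%:R^-1)).

End Framework.

(* The configurations for which ceil(y) >= x and y >= floor(x) differ: if x is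
   an integer, ceil(y) >= x means y > x - 1; otherwise it means y > floor(x). *)
Definition rounding_exception (R : realType) (x y : R) : bool :=
  if x \is a Num.int then x - 1 < y < x else y == (Num.floor x)%:~R.

(* Main.v *)
(* The agreed outcome is one of the proposals, so it minimizes some agent's
   effective cost, whose weights are wbar plus 1/r on that agent.  Comparing it
   with the optimum costs B/r for the extra term and at most B * delta_r for
   replacing wbar by the uniform weights, since a difference of two outcomes is
   at most B for every agent.  Each unit step of w adds 1 to its norm, so
   alpha_r = r.  Since 1 <= rterm <= ceil (kappa * B), B is positive and the
   divisions are genuine.  The rest is arithmetic of ceilings: for an integer
   m, m <= ceil y iff m - 1 < y. *)
Require Import Defs.
From mathcomp Require Import lra.

Import Order.TTheory GRing.Theory Num.Theory.
Local Open Scope ring_scope.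

Section Rounding.
Variable R : realType.
Implicit Types x y : R.

Lemma le_ceil_int x y :
  (x <= (Num.ceil y)%:~R) = ((Num.ceil x - 1)%:~R < y).
Proof. by rewrite -ceil_le_int -ceil_gt_int ltrBlDr ltzD1. Qed.

(** By [le_ceil_int] the left side is [ceil x - 1 < y]. Off the integers [ceil x - 1] is [floor x],
    so strict and weak comparison part only at [y = floor x]. *)
Lemma le_ceil_floor x y : ~~ rounding_exception x y ->
  (x <= (Num.ceil y)%:~R) = ((Num.floor x)%:~R <= y).
Proof.
rewrite le_ceil_int /rounding_exception; case: ifPn => [xint|xnint] nexc.
  have fx : (Num.floor x)%:~R = x by apply/eqP; rewrite -intrEfloor.
  (* For integral [x] it remains to compare [x - 1 < y] with [x <= y]; for [y < x] the hypothesis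
     makes both false. *)
  have cx : (Num.ceil x)%:~R = x by apply/eqP; rewrite -intrEceil.
  rewrite rmorphB /= fx cx; case: (leP x y) nexc => [xy _|_].
    by apply: lt_le_trans xy; rewrite ltrBlDr ltrDl.
  by rewrite andbT => /negbTE.
have -> : Num.ceil x = Num.floor x + 1.
  by rewrite ceil_floor (negbTE xnint).
by rewrite addrK lt_neqAle eq_sym nexc.
Qed.

End Rounding.

Lemma l1norm_nneg (R : realType) n (v : 'cV[R]_n) :
  (forall i, 0 <= v i 0) -> l1norm v = \sum_i v i 0.
Proof. by move=> v_ge0; apply: eq_bigr => i _; rewrite ger0_norm. Qed.

Section Framework.
Set Implicit Arguments.
Unset Strict Implicit.
Variables (R : realType) (n : nat) (Ch : finType) (F : framework R n Ch).

Lemma dist_Jind_le_Bmax i o o' : `|Jind F i o - Jind F i o'| <= Bmax F.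
Proof.
apply: le_trans (le_bigmax _ _ i).
apply: le_trans (le_bigmax _ _ o).
exact: (le_bigmax _ (fun o' => `|Jind F i o - Jind F i o'|)).
Qed.

Lemma SvB (v v' : 'cV[R]_n) o : Sv F (v - v') o = Sv F v o - Sv F v' o.
Proof. by rewrite -sumrB; apply: eq_bigr => i _; rewrite !mxE mulrBl. Qed.

(** Hölder's inequality, weights in l1 and cost differences in sup norm. Signed weights are allowed,
    so it applies to [v - u]. *)
Lemma dist_Sv_le (v : 'cV[R]_n) o o' :
  `|Sv F v o - Sv F v o'| <= Bmax F * l1norm v.
Proof.
rewrite -sumrB; apply: le_trans (ler_norm_sum _ _ _) _.
rewrite mulr_sumr; apply: ler_sum => i _.
by rewrite -mulrBr normrM mulrC ler_wpM2r ?dist_Jind_le_Bmax.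
Qed.

Lemma JsysE o : (0 < n)%N -> Jsys F o = n%:R * Sv F (const_mx n%:R^-1) o.
Proof.
move=> n_gt0; rewrite mulr_sumr; apply: eq_bigr => i _.
by rewrite mxE mulrA divff ?mul1r // pnatr_eq0 -lt0n.
Qed.

Lemma consensus_selected C A (tr : taco_trace R n Ch) t o :
  (0 < n)%N -> consensus F C A tr t o -> exists2 k, (k < t)%N & sel tr k = o.
Proof.
move=> n_gt0 [[nt sel_o]|[s [i [_ _ [k /andP[_ kt] selk]]]]]; last by exists k.
(* Since [n > 0], the window of the last [n] steps is nonempty; its last step [t.-1] is the
   witness. *)
have t_gt0 : (0 < t)%N by apply: leq_trans nt.
exists t.-1; first by rewrite prednK.
by apply: sel_o; rewrite prednK // leqnn andbT -subn1 leq_sub2l.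
Qed.

Lemma taco_run_mem C A (tr : taco_trace R n Ch) o :
  (0 < n)%N -> taco_run F C A tr o -> o \in A.
Proof.
move=> n_gt0 [_ step _ /(consensus_selected n_gt0)[k kt <-]].
by have [] := step _ kt.
Qed.

(** With [u] the uniform weights, [Sv u = Sv v - Sv (v - u)]: minimality controls the first term up
    to [a] times a cost difference of agent [j], and [dist_Sv_le] the second. *)
Lemma Jsys_gap_le (v : 'cV[R]_n) (a : R) (j : 'I_n) o :
  (0 < n)%N -> 0 <= a ->
  argmin (fun o => Sv F v o + a * Jind F j o) o ->
  forall o', Jsys F o - Jsys F o' <=
    n%:R * (Bmax F * l1norm (v - const_mx n%:R^-1) + Bmax F * a).
Proof.
move=> n_gt0 a_ge0 omin o'; rewrite !JsysE // -mulrBr ler_wpM2l //.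
have := dist_Sv_le (v - const_mx n%:R^-1) o o'.
have : a * (Jind F j o' - Jind F j o) <= Bmax F * a.
  by rewrite mulrC ler_wpM2r // (le_trans (ler_norm _)) ?dist_Jind_le_Bmax.
have := omin o'; rewrite !SvB ler_norml mulrBr => h1 h2 /andP[h3 _].
lra.
Qed.

Variable N : negotiation R n Ch.

Lemma shortfall_ge0 r i : 0 <= shortfall F N r i.
Proof.
by rewrite mulr_ge0 ?invr_ge0 ?(ltW (reserve_gt0 F i)) // le_max lexx.
Qed.

(** Each increment is the shortfall vector divided by its total, which is nonzero before
    termination, so its nonnegative entries sum to 1. The index is shifted because [w N 1 = 0]. *)
Lemma w_nneg_sum rterm r : terminates_at F N rterm -> (r < rterm)%N ->
  (forall i, 0 <= w N r.+1 i 0) /\ \sum_i w N r.+1 i 0 = r%:R.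
Proof.
move=> [_ w1 _ step _]; elim: r => [|r IHr] rt.
  by rewrite w1; split=> [i|]; rewrite ?big1 // => *; rewrite mxE.
have [w_ge0 sum_w] := IHr (ltnW rt).
have [tot_neq0 ->] := step r.+1 rt.
split=> [i|].
  rewrite !mxE addr_ge0 // divr_ge0 ?shortfall_ge0 //.
  by apply: sumr_ge0 => k _; apply: shortfall_ge0.
under eq_bigr do rewrite !mxE.
by rewrite big_split /= sum_w -mulr_suml divff // natr1.
Qed.

Lemma alphaE rterm r : terminates_at F N rterm -> (0 < r <= rterm)%N ->
  alpha N r = r%:R.
Proof.
case: r => // r hN /= rt; have [w_ge0 sum_w] := w_nneg_sum hN rt.
by rewrite /alpha l1norm_nneg // sum_w natr1.
Qed.

Lemma outcome_gap_le rterm r : (0 < n)%N -> terminates_at F N rterm ->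
  (0 < r <= rterm)%N ->
  forall o, Jsys F (outcome N r) - Jsys F o <=
    n%:R * (Bmax F * delta N r + Bmax F / r%:R).
Proof.
move=> n_gt0 hN rt; have [_ _ /(_ _ rt)[min_prop run _] _ _] := hN.
have /imsetP[j _ ->] := taco_run_mem n_gt0 run.
(* Writing [r] as [alpha N r] gives [Jeff] the form required by [Jsys_gap_le], with [v = wbar N r]
   and [a = (alpha N r)^-1]. *)
rewrite -(alphaE hN rt); apply: Jsys_gap_le => //; last exact: min_prop.
by rewrite (alphaE hN rt) invr_ge0.
Qed.

Lemma rmax_gt0_Bmax_gt0 : 0 < rmax F -> 0 < Bmax F.
Proof. by rewrite ceil_gt0 pmulr_rgt0 ?kappa_gt0. Qed.

End Framework.

Theorem theorem3 (R : realType) (n : nat) (Ch : finType) (F : framework R n Ch)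
    (hn : (0 < n)%N)
    (N : negotiation R n Ch) (rterm : nat) (hN : terminates_at F N rterm)
    (hterm : rterm%:Z <= rmax F)
    (oopt : Ch) (hopt : argmin (Jsys F) oopt)
    (dbar : R)
    (hdbar : forall r : nat, (1 <= r <= rterm)%N -> r%:Z <= rmax F ->
       delta N r <= dbar)
    (tau : R) (htau : 0 < tau) :
  let gap := Jsys F (outcome N rterm) - Jsys F oopt in
  let bound := n%:R * (Bmax F * dbar + Bmax F / rterm%:R) in
  let x := n%:R * Bmax F / (tau - n%:R * Bmax F * dbar) in
  [/\ gap <= bound,
      bound <= tau -> n%:R * Bmax F * dbar < tau /\ x <= (rmax F)%:~R,
      n%:R * Bmax F * dbar < tau ->
        (x <= (rmax F)%:~R <-> kappa F > (Bmax F)^-1 * (Num.ceil x - 1)%:~R)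
    & n%:R * Bmax F * dbar < tau ->
        ~~ rounding_exception x (kappa F * Bmax F) ->
        (x <= (rmax F)%:~R <-> kappa F >= (Bmax F)^-1 * (Num.floor x)%:~R)].
Proof.
move=> gap bound x.
have [rterm_gt0 _ _ _ _] := hN.
have rterm_rng : (0 < rterm <= rterm)%N by rewrite rterm_gt0 leqnn.
have B_gt0 : 0 < Bmax F.
  by apply: rmax_gt0_Bmax_gt0; apply: lt_le_trans hterm; rewrite ltz_nat.
have nB_gt0 : 0 < n%:R * Bmax F by rewrite mulr_gt0 ?ltr0n.
have rterm_gt0R : 0 < rterm%:R :> R by rewrite ltr0n.
split=> [||_|_ nexc].
- have dle : delta N rterm <= dbar by apply: hdbar => //; rewrite rterm_rng.
  apply: le_trans (outcome_gap_le hn hN rterm_rng oopt) _.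
  by rewrite ler_wpM2l // lerD2r ler_wpM2l ?(ltW B_gt0).
- rewrite /bound mulrDr !mulrA -lerBrDl => le_tau.
  (* The positive term [n * Bmax / rterm] lies below this difference, hence the strict
     inequality. *)
  have diff_gt0 : 0 < tau - n%:R * Bmax F * dbar.
    by apply: lt_le_trans le_tau; rewrite divr_gt0.
  split; first by move: diff_gt0; rewrite subr_gt0.
  (* The chain is [x <= rterm <= rmax]. *)
  apply: (@le_trans _ _ rterm%:R); last first.
    by rewrite -[_%:R]/(rterm%:Z%:~R) ler_int.
  by rewrite ler_pdivrMr // [leRHS]mulrC -ler_pdivrMr.
- by rewrite /rmax le_ceil_int [_^-1 * _]mulrC ltr_pdivrMr.
- by rewrite /rmax le_ceil_floor // [_^-1 * _]mulrC ler_pdivrMr.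
Qed.
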